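(* Let $\Omega=\{\Omega(n)\}_{n=1}^{\infty}$ be an expanding system of $\mathbb{Z}^2$. If there exists $m\ge1$ such that $$\limsup_{n\to\infty}\frac{\beta_m^{(h)}(n)}{|\Omega(n)|}>0\qquad\text{or}\qquad \limsup_{n\to\infty}\frac{\beta_m^{(v)}(n)}{|\Omega(n)|}>0,$$ then there exists an additive shift of finite type $\mathcal{U}$ (over some alphabet $\{0,1,\dots,N-1\}$, $N\ge2$, on $\mathbb{Z}^2$) such that $$h_\Omega(\mathcal{U})>h_r(\mathcal{U}).$$
   Context: Let $\mathcal{A}=\{0,1,\dots,N-1\}$ with $N\ge2$. An additive shift space $\mathcal{U}\subseteq\mathcal{A}^{\mathbb{Z}^2}$ is a subset that is closed (in the product topology) and invariant under all shifts $\sigma^{\mathbf{v}}$, $\mathbf{v}\in\mathbb{Z}^2$, where $(\sigma^{\mathbf{v}}(x))_{i,j}=x_{(i,j)+\mathbf{v}}$. It is a shift of finite type if there is a finite set $\mathcal{F}$ of forbidden patterns (elements of $\mathcal{A}^{\mathbb{S}}$ for finite shapes $\mathbb{S}\subset\mathbb{Z}^2$) such that $\mathcal{U}$ is the set of all $x\in\mathcal{A}^{\mathbb{Z}^2}$ such that $\sigma^{\mathbf{v}}(x)|_{\mathbb{S}}\notin\mathcal{F}$ for every $\mathbf{v}\in\mathbb{Z}^2$ and every shape $\mathbb{S}$ of a pattern in $\mathcal{F}$. An expanding system $\Omega=\{\Omega(n)\}_{n=1}^\infty$ of $\mathbb{Z}^2$ is a sequence of finite nonempty subsets $\Omega(n)\subset\mathbb{Z}^2$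 with $\Omega(n)\subseteq\Omega(n+1)$ for all $n$ and $\bigcup_{n\ge1}\Omega(n)=\mathbb{Z}^2$. For finite $\mathbb{L}\subset\mathbb{Z}^2$ let $\Gamma(\mathbb{L},\mathcal{U})=|\{x|_{\mathbb{L}}: x\in\mathcal{U}\}|$, and $$h_\Omega(\mathcal{U})=\limsup_{n\to\infty}\frac{1}{|\Omega(n)|}\log\Gamma(\Omega(n),\mathcal{U}).$$ For $m,n\ge1$ and $(i,j)\in\mathbb{Z}^2$, let $\mathbb{Z}_{m\times n}((i,j))=\{(i+n_1,j+n_2):0\le n_1\le m-1,\ 0\le n_2\le n-1\}$ and $\mathbb{Z}_{m\times n}=\mathbb{Z}_{m\times n}((0,0))$. The rectangular entropy is $$h_r(\mathcal{U})=\limsup_{m,n\to\infty}\frac{1}{mn}\log\Gamma(\mathbb{Z}_{m\times n},\mathcal{U})$$ (the limit exists and equals $\inf_{m,n\ge1}\frac1{mn}\log\Gamma(\mathbb{Z}_{m\times n},\mathcal{U})$). For a finite $\mathbb{L}\subset\mathbb{Z}^2$ and $m\ge1$, a point $(i,j)\in\mathbb{L}$ has horizontal length $m$ in $\mathbb{L}$ if $m$ is the largest positive integer for which there is $(r,s)\in\mathbb{L}$ with $(i,j)\in\mathbb{Z}_{m\times1}((r,s))\subseteq\mathbb{L}$; it has vertical length $m$ in $\mathbb{L}$ if $m$ is the largest positive integer for which there is $(r',s')\in\mathbb{L}$ with $(i,j)\in\mathbb{Z}_{1\times m}((r',s'))\subseteq\mathbb{L}$. Then $\beta_m^{(h)}(n)$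 (respectively $\beta_m^{(v)}(n)$) is the number of points of $\Omega(n)$ having horizontal (respectively vertical) length $m$ in $\Omega(n)$. *)

(* Defs.v *)
From HB Require Import structures.
From mathcomp Require Import all_boot all_order all_algebra finmap.
From mathcomp Require Import all_classical all_reals all_analysis.

Set Implicit Arguments.
Unset Strict Implicit.
Unset Printing Implicit Defensive.

Import Order.TTheory GRing.Theory Num.Theory.

Local Open Scope classical_set_scope.
Local Open Scope ring_scope.

Definition Z2 : zmodType := (int * int)%type.

Definition config (N : nat) : Type := Z2 -> 'I_N.

Definition sigma (N : nat) (v : Z2) (x : config N) : config N :=
  fun u => x (u + v).

Definition restriction (N : nat) (L : {fset Z2}) (x : config N) :
    {ffun L -> 'I_N} :=
  [ffun u => x (val u)].

Definition pattern (N : nat) : Type := {S : {fset Z2} & {ffun S -> 'I_N}}.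

Definition restrict_pattern (N : nat) (S : {fset Z2}) (x : config N) :
    pattern N :=
  existT (fun S : {fset Z2} => {ffun S -> 'I_N}) S (restriction S x).

Definition product_closed (N : nat) (U : set (config N)) : Prop :=
  @closed (prod_topology (fun _ : Z2 => discrete_topology 'I_N)) U.

Definition is_shift_space (N : nat) (U : set (config N)) : Prop :=
  product_closed U /\ (forall v x, U x -> U (sigma v x)).

Definition avoids (N : nat) (F : set (pattern N)) (x : config N) : Prop :=
  forall (v : Z2) (p : pattern N), F p ->
    ~ F (restrict_pattern (projT1 p) (sigma v x)).

Definition is_SFT (N : nat) (U : set (config N)) : Prop :=
  is_shift_space U /\
  exists2 F : set (pattern N), finite_set F & U = [set x | avoids F x].

(* Only the terms Omega n with n >= 1 are part of the system; Omega 0 is a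
   junk value, which no limsup below depends on. *)
Definition expanding_system (Omega : nat -> {fset Z2}) : Prop :=
  [/\ forall n, (1 <= n)%N -> Omega n != fset0,
      forall n, (1 <= n)%N -> (Omega n `<=` Omega n.+1)%fset &
      forall v : Z2, exists2 n, (1 <= n)%N & v \in Omega n].

Definition pattern_count (N : nat) (L : {fset Z2}) (U : set (config N)) : nat :=
  #|[set p : {ffun L -> 'I_N} | `[< exists2 x, U x & restriction L x = p >]]%SET|.

(* If U is empty then ln 0 = 0 replaces log 0 = -oo, in both entropies. *)
Definition entropy_density (R : realType) (N : nat) (L : {fset Z2})
    (U : set (config N)) : R :=
  ln (pattern_count L U)%:R / #|` L|%:R.

Definition h_sys (R : realType) (N : nat) (Omega : nat -> {fset Z2})
    (U : set (config N)) : \bar R :=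
  limn_esup (fun n => (entropy_density R (Omega n) U)%:E).

Definition rect (m n : nat) (v : Z2) : {fset Z2} :=
  [fset ((v.1 + a%:Z)%R, (v.2 + b%:Z)%R)
    | a in iota 0 m, b in iota 0 n]%fset.

Definition h_rect (R : realType) (N : nat) (U : set (config N)) : \bar R :=
  limf_esup
    (fun p : nat * nat =>
       (ln (pattern_count (rect p.1 p.2 0) U)%:R / (p.1 * p.2)%:R : R)%:E)
    (filter_prod \oo \oo).

Definition in_hsegment (L : {fset Z2}) (v : Z2) (m : nat) : Prop :=
  exists2 r, r \in L & v \in rect m 1 r /\ (rect m 1 r `<=` L)%fset.

Definition in_vsegment (L : {fset Z2}) (v : Z2) (m : nat) : Prop :=
  exists2 r, r \in L & v \in rect 1 m r /\ (rect 1 m r `<=` L)%fset.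

Definition has_hlength (L : {fset Z2}) (v : Z2) (m : nat) : Prop :=
  [/\ (1 <= m)%N, in_hsegment L v m &
      forall k, (1 <= k)%N -> in_hsegment L v k -> (k <= m)%N].

Definition has_vlength (L : {fset Z2}) (v : Z2) (m : nat) : Prop :=
  [/\ (1 <= m)%N, in_vsegment L v m &
      forall k, (1 <= k)%N -> in_vsegment L v k -> (k <= m)%N].

Definition beta_h (Omega : nat -> {fset Z2}) (m n : nat) : nat :=
  #|` [fset v in Omega n | `[< has_hlength (Omega n) v m >]]%fset|.

Definition beta_v (Omega : nat -> {fset Z2}) (m n : nat) : nat :=
  #|` [fset v in Omega n | `[< has_vlength (Omega n) v m >]]%fset|.

(* Main.v *)
(* Take for U the hard-core shift in direction e, where e is the horizontal or
   the vertical unit vector: binary configurations without two 1s at u and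
   u + e. A single gap decouples two segments, so the number of patterns on a
   finite L is the product, over the maximal e-segments of L, of the Fibonacci
   numbers p(k), with k the length of the segment. Since
   (11/10) phi^k <= p(k) <= 2 phi^k for phi the golden ratio and k >= 1, a set
   with s maximal segments has between (11/10)^s phi^|L| and 2^s phi^|L|
   patterns. An a x b rectangle has at most a + b segments, whence
   h_r <= ln phi; and Omega(n) has at least beta_m(n) / m segments, whence
   h_Omega >= ln phi + (ln (11/10) / m) limsup beta_m(n) / |Omega(n)|. *)

Require Import Defs.
From mathcomp Require Import all_boot all_order all_algebra finmap.
From mathcomp Require Import all_classical all_reals all_analysis.
From mathcomp Require Import zify ring lra.

Set Implicit Arguments.
Unset Strict Implicit.
Unset Printing Implicit Defensive.

Import Order.TTheory GRing.Theory Num.Theory.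

Local Open Scope classical_set_scope.
Local Open Scope ring_scope.

(* Each maximal e-segment of L has exactly one starting point, so the
   cardinality of [starts e L] is the number of these segments. *)
Definition starts (e : Z2) (L : {fset Z2}) : {fset Z2} :=
  [fset v in L | (v - e)%R \notin L]%fset.

Definition indep_sets (e : Z2) (L : {fset Z2}) : {fset {fset Z2}} :=
  [fset A in fpowerset L | all (fun u : Z2 => (u + e)%R \notin A) A]%fset.

Arguments indep_sets : simpl never.

Definition indep_count (e : Z2) (L : {fset Z2}) : nat := #|` indep_sets e L|.

Lemma indep_setsP (e : Z2) (L A : {fset Z2}) :
  reflect ((A `<=` L)%fset /\ forall u, u \in A -> u + e \notin A)
          (A \in indep_sets e L).
Proof.
rewrite !inE /= fpowersetE; apply: (iffP andP) => -[AL /=].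
  by move=> /allP h; split=> // u /h.
by move=> h; split=> //; apply/allP=> u /h.
Qed.

Lemma in_starts (e : Z2) (L : {fset Z2}) (v : Z2) :
  (v \in starts e L) = (v \in L) && (v - e \notin L).
Proof. by rewrite !inE. Qed.

Lemma starts_rem (e : Z2) (L : {fset Z2}) (v : Z2) :
  v + e \notin L -> starts e (L `\ v)%fset = (starts e L `\ v)%fset.
Proof.
move=> veL; apply/fsetP=> u; rewrite !inE /=; apply/idP/idP.
  case/andP=> /andP[-> uL]; rewrite uL negb_and negbK => /orP[/eqP ueq|->//].
  by move: veL; rewrite -ueq subrK uL.
by case/and3P=> -> -> /negbTE ->; rewrite andbF.
Qed.

Lemma card_starts_rem (e : Z2) (L : {fset Z2}) (v : Z2) :
  v \in L -> v + e \notin L ->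
  #|` starts e L| = ((v - e \notin L)%R + #|` starts e (L `\ v)%fset|)%N.
Proof.
by move=> vL veL; rewrite (cardfsD1 v) starts_rem // !inE /= vL.
Qed.

Lemma indep_countD1 (e : Z2) (L : {fset Z2}) (v : Z2) : e != 0 ->
  v \in L -> v + e \notin L ->
  indep_count e L = (indep_count e (L `\ v)%fset +
                         indep_count e (L `\ v `\ (v - e)%R)%fset)%N.
Proof.
move=> e0 vL veL; rewrite /indep_count.
have vev : v - e != v by rewrite -subr_eq0 addrAC subrr add0r oppr_eq0.
set J := indep_sets e (L `\ v `\ (v - e)%R)%fset.
have inJ A : A \in J -> [/\ v \notin A, v - e \notin A, (A `<=` L)%fset &
    forall u, u \in A -> u + e \notin A].
  case/indep_setsP=> /fsubsetP AJ Ai; split=> //.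
  - by apply/negP=> /AJ; rewrite !inE eqxx andbF.
  - by apply/negP=> /AJ; rewrite !inE eqxx.
  - by apply/fsubsetP=> u /AJ; rewrite !inE => /and3P[].
have cJ : #|` [fset (v |` A)%fset | A in J]%fset| = #|` J|.
  rewrite card_in_imfset // => A B /inJ[vA _ _ _] /inJ[vB _ _ _] AB.
  by rewrite -(fsetU1K vA) AB fsetU1K.
rewrite -[X in (_ + X)%N]cJ.
rewrite -cardfsUI [X in (_ + X)%N](_ : _ = 0%N) ?addn0; last first.
  apply/eqP; rewrite cardfs_eq0; apply/eqP/fsetP=> A.
  rewrite in_fsetI in_fset0; apply/negP=> /andP[/indep_setsP[/fsubsetP AL _]].
  case/imfsetP=> B /= BJ AE.
  by have := AL v; rewrite AE !inE eqxx => /(_ isT).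
congr #|` _|; apply/fsetP=> A; rewrite in_fsetU; apply/idP/idP.
  case/indep_setsP=> /fsubsetP AL Ai; apply/orP.
  have [vA|vA] := boolP (v \in A); last first.
    left; apply/indep_setsP; split=> //; apply/fsubsetP=> u uA.
    by rewrite !inE AL // andbT; apply: contraNneq vA => <-.
  right; apply/imfsetP; exists (A `\ v)%fset; rewrite ?fsetD1K //=.
  apply/indep_setsP; split.
    apply/fsubsetP=> u; rewrite !inE => /andP[uv uA].
    rewrite uv AL //= andbT; apply: contraTneq vA => ue.
    by rewrite -(subrK e v) -ue Ai.
  by move=> u; rewrite !inE => /andP[_ uA]; rewrite negb_and Ai ?orbT.
case/orP.
  case/indep_setsP=> /fsubsetP AL Ai; apply/indep_setsP; split=> //.
  by apply/fsubsetP=> u /AL; rewrite !inE => /andP[].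
case/imfsetP=> B /= /inJ[vB veB /fsubsetP BL Bi] ->.
apply/indep_setsP; split.
  by apply/fsubsetP=> u; rewrite !inE => /predU1P[->//|/BL].
move=> u; rewrite !inE => /predU1P[->|uB].
  rewrite negb_or; apply/andP; split.
    by rewrite -subr_eq0 addrAC subrr add0r.
  by apply: contra veL => /BL.
rewrite negb_or Bi // andbT; apply: contra veB => /eqP <-.
by rewrite addrK.
Qed.

Lemma indep_count0 (e : Z2) : indep_count e fset0 = 1%N.
Proof.
suff h : indep_sets e fset0 = [fset fset0]%fset by rewrite /indep_count h cardfs1.
apply/fsetP=> A; rewrite in_fset1; apply/indep_setsP/eqP=> [[]|->].
  by rewrite fsubset0 => /eqP.
by split.
Qed.

Lemma last_point (e : Z2) (L : {fset Z2}) : e.1 + e.2 = 1 -> L != fset0 ->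
  exists2 v, v \in L & v + e \notin L.
Proof.
move=> e1 /fset0Pn[v0 v0L].
case: (arg_maxP (fun u : L => (val u).1 + (val u).2) (i0 := [` v0L]%fset)
  (P := predT)) => //= v _ vmax.
exists (val v); first exact: valP.
apply/negP=> vL; have := vmax [` vL]%fset isT; rewrite /=.
by move: e1; clear; case: (val v) e => [a b] [c d] /=; lia.
Qed.

Lemma mem_remD (e : Z2) (L : {fset Z2}) (v : Z2) :
  e != 0 -> v - e \in L -> v - e \in (L `\ v)%fset.
Proof. by move=> e0 vL; rewrite !inE vL andbT -subr_eq0 addrAC subrr add0r oppr_eq0. Qed.

Lemma indep_count_isolated (e : Z2) (L : {fset Z2}) (v : Z2) : e != 0 ->
  v \in L -> v + e \notin L -> v - e \notin L ->
  indep_count e L = (2 * indep_count e (L `\ v)%fset)%N.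
Proof.
move=> e0 vL veL vmL; rewrite (indep_countD1 e0 vL veL).
rewrite [(_ `\ (v - e)%R)%fset](_ : _ = L `\ v)%fset ?mul2n ?addnn //.
by apply/mem_fsetD1; rewrite !inE (negbTE vmL) andbF.
Qed.

Lemma peel_ind (e : Z2) (P : {fset Z2} -> Prop) : e.1 + e.2 = 1 ->
  P fset0 ->
  (forall L v, v \in L -> v + e \notin L -> v - e \notin L ->
    P (L `\ v)%fset -> P L) ->
  (forall L v, v \in L -> v + e \notin L -> v - e \in L ->
    P (L `\ v)%fset -> P (L `\ v `\ (v - e)%R)%fset -> P L) ->
  forall L, P L.
Proof.
move=> e1 P0 P1 P2 L; have [n] := ubnP #|` L|; elim: n L => // n IH L Ln.
have [->|/(last_point e1)[v vL veL]] := eqVneq L fset0; first exact: P0.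
have L1n : (#|` (L `\ v)%fset| < n)%N by move: Ln; rewrite (cardfsD1 v) vL.
have [vmL|vmL] := boolP (v - e \in L); last by apply: P1 (IH _ L1n).
apply: P2 (IH _ L1n) (IH _ _) => //.
by apply: leq_ltn_trans L1n; rewrite fsubset_leq_card // fsubD1set.
Qed.

Section golden.
Variables (R : realType) (phi : R) (e : Z2).
Hypotheses (phi_gt0 : 0 < phi) (phi2 : phi ^+ 2 = phi + 1) (e1 : e.1 + e.2 = 1).

Let e0 : e != 0. Proof. by apply/eqP=> e0; move: e1; rewrite e0. Qed.

Let phi_ge1 : 1 <= phi. Proof. by move: phi_gt0 phi2; nra. Qed.
Let phi_lt : phi < 17 / 10. Proof. by move: phi_gt0 phi2; nra. Qed.

Let phi_c_lt : phi * (11 / 10) <= 2. Proof. by move: phi_lt; lra. Qed.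
Let phi2_c_lt : phi ^+ 2 * (11 / 10) <= 3. Proof. by rewrite phi2; move: phi_lt; lra. Qed.

Let ub_step (x y p s t : R) : 0 <= p -> 1 <= s -> 0 <= t ->
  x <= phi * p * (s * t) -> y <= p * t -> x + y <= phi * (phi * p) * (s * t).
Proof.
move=> p0 s1 t0 xle yle; apply: le_trans (lerD xle yle) _.
have -> : phi * (phi * p) * (s * t) = phi ^+ 2 * (p * s * t) by ring.
rewrite phi2 mulrDl mul1r !mulrA lerD //.
by rewrite -[p * s * t]mulrA [s * t]mulrC mulrA ler_peMr // mulr_ge0.
Qed.

Let lb_step (x y p t : R) :
  phi * p * t <= x -> p * t <= y -> phi * (phi * p) * t <= x + y.
Proof.
move=> xle yle; apply: le_trans (lerD xle yle).
have -> : phi * (phi * p) * t = phi ^+ 2 * (p * t) by ring.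
by rewrite phi2 mulrDl !mul1r mulrA.
Qed.

Lemma indep_count_ub (L : {fset Z2}) :
  (indep_count e L)%:R <= phi ^+ #|` L| * 2 ^+ #|` starts e L|.
Proof.
move: L; apply: (peel_ind e1) => [|L v vL veL vmL|L v vL veL vmL].
- by rewrite indep_count0 cardfs0 expr0 mul1r exprn_ege1 // ler1n.
- rewrite (indep_count_isolated e0 vL veL vmL) (card_starts_rem vL veL) vmL.
  rewrite (cardfsD1 v L) vL !exprD !expr1 natrM => IH.
  rewrite mulrACA; apply: ler_pM => //.
  by rewrite ler_peMl.
have vmL' := mem_remD e0 vmL.
have vmeL : v - e + e \notin (L `\ v)%fset by rewrite subrK !inE eqxx.
rewrite (indep_countD1 e0 vL veL) (card_starts_rem vL veL) vmL add0n natrD.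
rewrite (cardfsD1 v L) vL (cardfsD1 (v - e) (L `\ v)%fset) vmL'.
rewrite (card_starts_rem vmL' vmeL) !exprD !expr1.
apply: ub_step; rewrite ?exprn_ge0 ?exprn_ege1 ?ler1n //.
exact: ltW.
Qed.

Lemma indep_count_lb (L : {fset Z2}) :
  phi ^+ #|` L| * (11 / 10) ^+ #|` starts e L| <= (indep_count e L)%:R.
Proof.
have c0 : 0 <= 11 / 10 :> R by lra.
move: L; apply: (peel_ind e1) => [|L v vL veL vmL|L v vL veL vmL].
- rewrite indep_count0 cardfs0 expr0 mul1r.
  rewrite [starts _ _](_ : _ = fset0) ?cardfs0 ?expr0 //.
  by apply/fsetP=> u; rewrite in_starts !inE.
- rewrite (indep_count_isolated e0 vL veL vmL) (card_starts_rem vL veL) vmL.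
  rewrite (cardfsD1 v L) vL !exprD !expr1 natrM => IH.
  rewrite mulrACA; apply: ler_pM IH => //.
  + by rewrite mulr_ge0 // ltW.
  + by rewrite mulr_ge0 ?exprn_ge0 // ltW.
have vmL' := mem_remD e0 vmL.
have vmeL : v - e + e \notin (L `\ v)%fset by rewrite subrK !inE eqxx.
rewrite (indep_countD1 e0 vL veL) (card_starts_rem vL veL) vmL add0n natrD.
rewrite (cardfsD1 v L) vL (cardfsD1 (v - e) (L `\ v)%fset) vmL'.
rewrite (card_starts_rem vmL' vmeL) !exprD !expr1.
have [veeL|veeL] := boolP (v - e - e \in (L `\ v)%fset).
  by rewrite /= expr0 mul1r; apply: lb_step.
rewrite (indep_count_isolated e0 vmL' vmeL veeL) natrM expr1 => _ IH.
rewrite [phi * (_ * _)]mulrA -expr2 mulrACA.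
apply: (@le_trans _ _ (3 * (indep_count e (L `\ v `\ (v - e)%R)%fset)%:R)).
  apply: ler_pM IH => //; rewrite ?mulr_ge0 ?exprn_ge0 // ltW //.
by rewrite -[3]/(2 + 1)%:R natrD mulrDl mul1r.
Qed.
End golden.

Definition hard_core (e : Z2) : set (config 2) :=
  [set x | forall u, ~~ ((x u == ord_max) && (x (u + e) == ord_max))].

Lemma pattern_count_hard_core (e : Z2) (L : {fset Z2}) :
  pattern_count L (hard_core e) = indep_count e L.
Proof.
pose g (A : {fset Z2}) : {ffun L -> 'I_2} :=
  [ffun u => if val u \in A then ord_max else ord0].
rewrite /pattern_count /indep_count cardE -(size_map g (indep_sets e L)).
apply/perm_size/uniq_perm; first exact: enum_uniq.
  rewrite map_inj_in_uniq ?fset_uniq // => A B.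
  move=> /indep_setsP[/fsubsetP AL _] /indep_setsP[/fsubsetP BL _] gAB.
  apply/fsetP=> u; have [uL|uL] := boolP (u \in L); last first.
    by rewrite (contraNF (AL u) uL) (contraNF (BL u) uL).
  have := congr1 (fun h : {ffun L -> 'I_2} => h [` uL]%fset) gAB.
  by rewrite !ffunE /=; case: (u \in A); case: (u \in B).
move=> p; rewrite mem_enum inE; apply/asboolP/mapP => [[x Ux <-]|].
  exists [fset u in L | x u == ord_max]%fset.
    apply/indep_setsP; split=> [|u]; first exact: fset_sub.
    rewrite !inE /= => /andP[_ xu]; rewrite negb_and; apply/orP; right.
    by have := Ux u; rewrite xu.
  apply/ffunP=> u; rewrite !ffunE !inE /= (valP u) /=.
  case: eqVneq => [//|]; case: (x _) => -[|[|//]] i ne; apply: val_inj => //=.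
case=> A /indep_setsP[_ Ai] ->.
exists (fun u => if u \in A then ord_max else ord0).
  move=> u /=; case: ifPn => // uA.
  by rewrite (negbTE (Ai _ uA)).
by apply/ffunP=> u; rewrite !ffunE.
Qed.

Lemma hard_core_closed (e : Z2) : product_closed (hard_core e).
Proof.
pose T : Z2 -> topologicalType := fun _ => discrete_topology 'I_2.
have -> : hard_core e = \bigcap_(u in setT)
    ((@proj Z2 T u @^-1` [set a | a != ord_max :> 'I_2]) `|`
     (@proj Z2 T (u + e) @^-1` [set a | a != ord_max :> 'I_2])).
  apply/seteqP; split=> x /=.
    move=> Ux u _; have := Ux u; rewrite negb_and => /orP[]; by [left|right].
  by move=> Ux u; have := Ux u I; rewrite negb_and => -[] h; apply/orP; [left|right].
apply: closed_bigI => u _; apply: closedU.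
  apply: closed_comp; last exact: discrete_closed.
  by move=> x _; exact: proj_continuous.
apply: closed_comp; last exact: discrete_closed.
by move=> x _; exact: proj_continuous.
Qed.

Lemma restrict_pattern_eq (N : nat) (S : {fset Z2}) (x y : config N) (u : Z2) :
  restrict_pattern S x = restrict_pattern S y -> u \in S -> x u = y u.
Proof.
move=> xy uS; pose value (p : pattern N) := omap (projT2 p) (insub u).
have := congr1 value xy.
by rewrite /value /= insubT /= !ffunE => -[].
Qed.

Lemma hard_core_SFT (e : Z2) : is_SFT (hard_core e).
Proof.
split; first split; first exact: hard_core_closed.
  by move=> v x Ux u; rewrite /sigma addrAC.
pose S : {fset Z2} := [fset 0; e]%fset.
pose ones : config 2 := fun _ => ord_max.
exists [set restrict_pattern S ones]; first exact: finite_set1.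
apply/seteqP; split=> x /=.
  move=> Ux v p -> /= xv; have /negP := Ux v; apply.
  have := restrict_pattern_eq xv; rewrite /sigma => {}xv.
  have := xv 0; rewrite !inE eqxx add0r => ->//=.
  by have := xv e; rewrite !inE eqxx orbT addrC => ->.
move=> xF u; apply/negP=> /andP[/eqP x0 /eqP xe].
apply: (xF u _ erefl); rewrite /= /restrict_pattern; congr existT.
apply/ffunP=> w; rewrite !ffunE /sigma; have := valP w; rewrite !inE.
by case/orP=> /eqP ->; rewrite ?add0r // addrC.
Qed.

Lemma in_rect (m n : nat) (r v : Z2) :
  reflect (exists a b : nat, [/\ (a < m)%N, (b < n)%N & v = (r.1 + a%:Z, r.2 + b%:Z)])
          (v \in rect m n r).
Proof.
rewrite /rect; apply: (iffP idP) => [/imfset2P[a + [b + ->]]|[a [b [am bn ->]]]].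
  rewrite -[in_mem a _]/(a \in iota 0 m) -[in_mem b _]/(b \in iota 0 n).
  by rewrite !mem_iota => am bn; exists a, b.
have am' : a \in iota 0 m by rewrite mem_iota.
have bn' : b \in iota 0 n by rewrite mem_iota.
exact: (in_imfset2 _ _ am' bn').
Qed.

Lemma card_rect (m n : nat) (r : Z2) : (#|` rect m n r| <= m * n)%N.
Proof.
rewrite -[X in (_ <= X * _)%N](size_iota 0) -[X in (_ <= _ * X)%N](size_iota 0).
rewrite -(size_allpairs (fun a b : nat => (r.1 + a%:Z, r.2 + b%:Z))).
apply: uniq_leq_size; first exact: fset_uniq.
move=> v /in_rect[a [b [am bn ->]]].
by apply/allpairsP; exists (a, b); rewrite !mem_iota.
Qed.

Definition hdir : Z2 := (1, 0).
Definition vdir : Z2 := (0, 1).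

Lemma card_starts_hrect (m n : nat) (r : Z2) :
  (#|` starts hdir (rect m n r)| <= n)%N.
Proof.
rewrite -[X in (_ <= X)%N](size_iota 0) -(size_map (fun b : nat => (r.1, r.2 + b%:Z)%R)).
apply: uniq_leq_size; first exact: fset_uniq.
move=> v; rewrite !inE => /andP[/in_rect[a [b [am bn ->]]] nv].
apply/mapP; exists b; rewrite ?mem_iota //.
case: a => [|a] in am nv *; first by rewrite addr0.
case/negP: nv; apply/in_rect; exists a, b; split=> //; first exact: ltnW.
by congr (_, _) => /=; lia.
Qed.

Lemma card_starts_vrect (m n : nat) (r : Z2) :
  (#|` starts vdir (rect m n r)| <= m)%N.
Proof.
rewrite -[X in (_ <= X)%N](size_iota 0) -(size_map (fun a : nat => (r.1 + a%:Z, r.2)%R)).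
apply: uniq_leq_size; first exact: fset_uniq.
move=> v; rewrite !inE => /andP[/in_rect[a [b [am bn ->]]] nv].
apply/mapP; exists a; rewrite ?mem_iota //.
case: b => [|b] in bn nv *; first by rewrite addr0.
case/negP: nv; apply/in_rect; exists a, b; split=> //; first exact: ltnW.
by congr (_, _) => /=; lia.
Qed.

Lemma card_le_starts (e : Z2) (L B : {fset Z2}) (m : nat) :
  (forall v, v \in B -> exists r (k : nat),
     [/\ r \in starts e L, (k < m)%N & v = r + e *+ k]) ->
  (#|` B| <= m * #|` starts e L|)%N.
Proof.
move=> BP; rewrite mulnC -[X in (_ <= _ * X)%N](size_iota 0).
rewrite -(size_allpairs (fun r k => r + e *+ k)).
apply: uniq_leq_size; first exact: fset_uniq.
move=> v /BP[r [k [rL km ->]]].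
by apply/allpairsP; exists (r, k); rewrite mem_iota.
Qed.

Lemma mulrn_pair (a b : int) (k : nat) : ((a, b) : Z2) *+ k = (a *+ k, b *+ k) :> Z2.
Proof. by elim: k => // k IH; rewrite !mulrS IH. Qed.

Lemma beta_h_le (Omega : nat -> {fset Z2}) (m n : nat) :
  (beta_h Omega m n <= m * #|` starts hdir (Omega n)|)%N.
Proof.
apply: card_le_starts => v; rewrite !inE /= => /andP[_ /asboolP[m1]].
case=> r rL [vr rectL] max.
have /in_rect[k [b [km b1 vE]]] := vr.
exists r, k; split=> //; last first.
  rewrite vE mulrn_pair; case: b b1 {vE} => // _.
  by case: (r) => x y; congr (_, _) => /=; lia.
rewrite !inE rL /=; apply/negP=> rL'.
have := max m.+1 isT; rewrite ltnn => maxF; apply: notF; apply: maxF.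
exists (r - hdir) => //; split.
  apply/in_rect; exists k.+1, b; split=> //; rewrite vE; congr (_, _) => /=; lia.
apply/fsubsetP=> w /in_rect[[|a] [b' [am b'1 ->]]].
  by case: b' b'1 => // _; rewrite !addr0 -surjective_pairing.
apply: (fsubsetP rectL); apply/in_rect; exists a, b'; split=> //.
congr (_, _) => /=; lia.
Qed.

Lemma beta_v_le (Omega : nat -> {fset Z2}) (m n : nat) :
  (beta_v Omega m n <= m * #|` starts vdir (Omega n)|)%N.
Proof.
apply: card_le_starts => v; rewrite !inE /= => /andP[_ /asboolP[m1]].
case=> r rL [vr rectL] max.
have /in_rect[a [k [a1 km vE]]] := vr.
exists r, k; split=> //; last first.
  rewrite vE mulrn_pair; case: a a1 {vE} => // _.
  by case: (r) => x y; congr (_, _) => /=; lia.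
rewrite !inE rL /=; apply/negP=> rL'.
have := max m.+1 isT; rewrite ltnn => maxF; apply: notF; apply: maxF.
exists (r - vdir) => //; split.
  apply/in_rect; exists a, k.+1; split=> //; rewrite vE; congr (_, _) => /=; lia.
apply/fsubsetP=> w /in_rect[a' [[|b] [a'1 bm ->]]].
  by case: a' a'1 => // _; rewrite !addr0 -surjective_pairing.
apply: (fsubsetP rectL); apply/in_rect; exists a', b; split=> //.
congr (_, _) => /=; lia.
Qed.

Lemma density_lt_limn_esup (R : realType) (u : nat -> R) :
  (0 < limn_esup (fun n => (u n)%:E))%E ->
  exists2 r : R, 0 < r & forall N, exists2 n, (N <= n)%N & r < u n.
Proof.
set l := limn_esup _ => l0.
have [r r0 rl] : exists2 r : R, 0 < r & (r%:E < l)%E.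
  case: l l0 => [l|_|//]; last by exists 1; rewrite ?ltry.
  by rewrite lte_fin => l0; exists (l / 2); rewrite ?lte_fin; lra.
exists r => // N.
have : (r%:E < ereal_sup ((fun n => (u n)%:E) @` [set n | (N <= n)%N]))%E.
  apply: lt_le_trans rl _; apply: ereal_inf_lbound.
  by exists [set n | (N <= n)%N] => //; exact: nbhs_infty_ge.
case/ereal_sup_gt => _ [n Nn <-]; rewrite lte_fin => ?.
by exists n.
Qed.

Lemma limn_esup_ge (R : realType) (u : nat -> R) (c : R) :
  (forall N, exists2 n, (N <= n)%N & c <= u n) ->
  (c%:E <= limn_esup (fun n => (u n)%:E))%E.
Proof.
move=> h; apply: le_ereal_inf_tmp => _ [V [N _ NV] <-].
have [n Nn cn] := h N.
apply: (@le_trans _ _ (u n)%:E); first by rewrite lee_fin.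
by apply: ereal_sup_ubound; exists n => //; apply: NV.
Qed.

Lemma h_rect_le (R : realType) (N : nat) (U : set (config N)) (c d : R) :
  0 <= d ->
  (forall a b : nat, (0 < a)%N -> (0 < b)%N ->
    ln (pattern_count (rect a b 0) U)%:R <= c * (a * b)%:R + d * (a + b)%:R) ->
  (h_rect R U <= c%:E)%E.
Proof.
move=> d0 h; apply/lee_addgt0Pr => eps eps0.
have [M Md] : exists M : nat, 2 * d < eps * M.+1%:R.
  exists (Num.truncn (2 * d / eps)).
  by rewrite [eps * _]mulrC -ltr_pdivrMr // truncnS_gt.
pose V := [set n | (M.+1 <= n)%N].
apply: (@le_trans _ _ (ereal_sup ((fun p : nat * nat =>
  (ln (pattern_count (rect p.1 p.2 0) U)%:R / (p.1 * p.2)%:R : R)%:E) @` (V `*` V)))).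
  apply: ereal_inf_lbound; exists (V `*` V) => //.
  by exists (V, V) => //; split; exact: nbhs_infty_ge.
apply: ge_ereal_sup => _ [[a b] /= [Va Vb] <-]; rewrite -EFinD lee_fin.
have a0 : (0 < a)%N by apply: leq_ltn_trans Va.
have b0 : (0 < b)%N by apply: leq_ltn_trans Vb.
rewrite ler_pdivrMr ?ltr0n ?muln_gt0 ?a0 //.
apply: le_trans (h _ _ a0 b0) _; rewrite mulrDl lerD2l natrD natrM.
have {}Va : M.+1%:R <= a%:R :> R by rewrite ler_nat.
have {}Vb : M.+1%:R <= b%:R :> R by rewrite ler_nat.
have {}a0 : 0 < a%:R :> R by rewrite ltr0n.
have {}b0 : 0 < b%:R :> R by rewrite ltr0n.
move: Md Va Vb a0 b0; move: M.+1%:R a%:R b%:R => m x y Md mx my x0 y0.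
have dx : 2 * d <= eps * x by apply: le_trans (ltW Md) _; rewrite ler_pM2l.
have dy : 2 * d <= eps * y by apply: le_trans (ltW Md) _; rewrite ler_pM2l.
have := ler_wpM2r (ltW y0) dx; have := ler_wpM2r (ltW x0) dy.
by move=> h1 h2; lra.
Qed.

Lemma h_sys_gt_h_rect (R : realType) (e : Z2) (Omega : nat -> {fset Z2})
    (m : nat) (beta : nat -> nat) :
  e.1 + e.2 = 1 -> expanding_system Omega -> (1 <= m)%N ->
  (forall n, (beta n <= m * #|` starts e (Omega n)|)%N) ->
  (forall a b, (#|` starts e (rect a b 0)| <= a + b)%N) ->
  (0 < limn_esup (fun n => ((beta n)%:R / #|` Omega n|%:R : R)%R%:E))%E ->
  (h_rect R (hard_core e) < h_sys R Omega (hard_core e))%E.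
Proof.
move=> e1 [neO _ _] m0 beta_le starts_le /density_lt_limn_esup[r r0 hr].
pose phi : R := (1 + Num.sqrt 5) / 2.
have s5 : Num.sqrt 5 ^+ 2 = 5 :> R by rewrite sqr_sqrtr.
have phi0 : 0 < phi by rewrite divr_gt0 // ltr_pwDl // sqrtr_ge0.
have phi2 : phi ^+ 2 = phi + 1.
  by rewrite /phi expr_div_n sqrrD s5; field.
have c0 : 0 < 11 / 10 :> R by lra.
have lnc0 : 0 < ln (11 / 10) :> R by apply: ln_gt0; lra.
have m0R : 0 < m%:R :> R by rewrite ltr0n.
have cnt_gt0 L : 0 < (indep_count e L)%:R :> R.
  apply: lt_le_trans (indep_count_lb phi0 phi2 e1 L).
  by rewrite mulr_gt0 // exprn_gt0.
have rect_le : (h_rect R (hard_core e) <= (ln phi)%:E)%E.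
  apply: (@h_rect_le _ _ _ _ (ln 2)); first by rewrite ln_ge0 // ler1n.
  move=> a b a0 b0; rewrite pattern_count_hard_core.
  have phi1 : 1 <= phi by move: phi0 phi2; nra.
  have -> : ln phi * (a * b)%:R + ln 2 * (a + b)%:R =
            ln (phi ^+ (a * b) * 2 ^+ (a + b)).
    by rewrite lnM ?posrE ?exprn_gt0 // !lnXn // !mulr_natr.
  rewrite ler_ln ?posrE ?mulr_gt0 ?exprn_gt0 //.
  apply: le_trans (indep_count_ub phi0 phi2 e1 _) _.
  apply: ler_pM; rewrite ?exprn_ge0 ?(ltW phi0) //.
    by apply: ler_weXn2l => //; exact: card_rect.
  by apply: ler_weXn2l; rewrite ?ler1n.
apply: le_lt_trans rect_le _.
apply: (@lt_le_trans _ _ (ln phi + ln (11 / 10) / m%:R * r)%:E).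
  by rewrite lte_fin ltrDl mulr_gt0 // divr_gt0.
apply: limn_esup_ge => N; have [n Nn rn] := hr N.+1.
exists n; first exact: ltnW.
have O0 : 0 < #|` Omega n|%:R :> R.
  by rewrite ltr0n cardfs_gt0 neO //; apply: leq_ltn_trans Nn.
rewrite /entropy_density pattern_count_hard_core ler_pdivlMr //.
apply: (@le_trans _ _ (ln (phi ^+ #|` Omega n| *
    (11 / 10) ^+ #|` starts e (Omega n)|))); last first.
  rewrite ler_ln ?posrE ?mulr_gt0 ?exprn_gt0 //.
  exact: indep_count_lb.
rewrite lnM ?posrE ?exprn_gt0 // !lnXn //.
rewrite -[ln phi *+ _]mulr_natr -[ln _ *+ _]mulr_natr.
rewrite mulrDl lerD2l -!mulrA ler_pM2l // mulrC ler_pdivrMr //.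
move: rn; rewrite ltr_pdivlMr // => /ltW rn.
by apply: le_trans rn _; rewrite -natrM ler_nat mulnC.
Qed.

Theorem theorem1p3 (R : realType) (Omega : nat -> {fset Z2})
    (hOmega : expanding_system Omega)
    (hbeta : exists m : nat, (1 <= m)%N /\
      ((0 < limn_esup (fun n : nat =>
          ((beta_h Omega m n)%:R / #|` Omega n|%:R : R)%R%:E))%E \/
       (0 < limn_esup (fun n : nat =>
          ((beta_v Omega m n)%:R / #|` Omega n|%:R : R)%R%:E))%E)) :
  exists (N : nat) (U : set (config N)),
    [/\ (2 <= N)%N, is_SFT U & (h_rect R U < h_sys R Omega U)%E].
Proof.
have [m [m0 [hb|vb]]] := hbeta.
  exists 2%N, (hard_core hdir); split=> //; first exact: hard_core_SFT.
  apply: (h_sys_gt_h_rect (m := m) (beta := beta_h Omega m)) => // [n|a b]; first exact: beta_h_le.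
  exact: leq_trans (card_starts_hrect _ _ _) (leq_addl _ _).
exists 2%N, (hard_core vdir); split=> //; first exact: hard_core_SFT.
apply: (h_sys_gt_h_rect (m := m) (beta := beta_v Omega m)) => // [n|a b]; first exact: beta_v_le.
exact: leq_trans (card_starts_vrect _ _ _) (leq_addr _ _).
Qed.
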